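(* Let $X$ be a completely regular Hausdorff topological space which is a dense subspace of a compact Hausdorff space $K$, and let $\Phi$ be a closed subspace of $\mathcal{C}(K)$ containing the constant functions and separating points in $X$. Let $S\subset X$ be a compact set. Then $$\overline{\mathrm{co}}_\Phi(S)=\overline{\mathrm{co}}_\Phi(\mathrm{Ext}_\Phi(S)).$$ Therefore, if $C\subset X$ is compact and convex-trace with respect to $\Phi$, then $C=\overline{\mathrm{co}}_\Phi(\mathrm{Ext}_\Phi(C))$.
   Context: $\mathcal{C}(K)$ is the Banach space of continuous real-valued functions on $K$ with the sup-norm, and $w^*$ is the weak-star topology of $\Phi^*$. $K(\Phi):=\{Q\in\Phi^*:\ \|Q\|=\langle Q,\mathbf 1\rangle=1\}$ (with $\mathbf 1$ the constant function $1$), a convex $w^*$-compact subset of $\Phi^*$. $\delta^\Phi:K\to K(\Phi)$ is $\delta^\Phi(x)(\phi)=\phi(x)$. A closed set $C\subset X$ is convex-trace with respect to $\Phi$ if there is a $w^*$-closed convex set $\widehat C\subset K(\Phi)$ with $\delta^\Phi(C)=\delta^\Phi(X)\cap\widehat C$. $\mathcal{P}_{TC}(X)$ denotes the set of all convex-trace subsets of $X$. For $S\subset X$, $\overline{\mathrm{co}}_\Phi(S):=\bigcap\{C\in\mathcal{P}_{TC}(X):\ S\subset C\}$. A point $x\in S$ is $\Phi$-extreme in $S$ if $\delta^\Phi(x)$ is an extreme point of the $w^*$-closed convex hull $\overline{\mathrm{co}}^{w^*}(\delta^\Phi(S))$ in $\Phi^*$; $\mathrm{Ext}_\Phi(S)$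 denotes the set of all $\Phi$-extreme points of $S$. *)

(* Defs.v *)
From HB Require Import structures.
From mathcomp Require Import all_boot all_order all_algebra.
From mathcomp Require Import all_classical all_reals all_analysis.

Set Implicit Arguments.
Unset Strict Implicit.
Unset Printing Implicit Defensive.

Import Order.TTheory GRing.Theory Num.Theory.
Import numFieldNormedType.Exports.

Local Open Scope classical_set_scope.
Local Open Scope ring_scope.

Section continuous_functions.
Context {K : topologicalType} {R : realType}.

Definition cont_pred : {pred K -> R} := mem [set f | continuous f].

Lemma cont_submod_closed : submod_closed cont_pred.
Proof.
split; first by rewrite inE => x; exact: cvg_cst.
move=> a f g; rewrite !inE => /= cf cg x.
exact: (@continuousD _ _ _ (a \*: f) g x
  (@continuousZr _ _ _ f a x (cf x)) (cg x)).
Qed.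

HB.instance Definition _ := GRing.isSubmodClosed.Build R (K -> R) cont_pred
  cont_submod_closed.

End continuous_functions.

(* Compactness of [K] is carried by the type: it is what makes the supremum of
   |f| a norm. *)
Definition Cfun {K : topologicalType} (R : realType)
  (cK : compact [set: K]) : Type := {f : K -> R | f \in cont_pred}.

Section Cfun_norm.
Context {K : topologicalType} {R : realType} {cK : compact [set: K]}.
Local Notation CK := (Cfun R cK).

HB.instance Definition _ := SubType.on CK.
HB.instance Definition _ := Choice.on CK.
HB.instance Definition _ := [SubChoice_isSubLmodule of CK by <:].

Definition Cfun_fun (f : CK) : K -> R := \val f.
Coercion Cfun_fun : Cfun >-> Funclass.

Lemma CfunP (f g : CK) : f =1 g -> f = g.
Proof. by move=> fg; apply/val_inj/funext. Qed.

Lemma Cfun_continuous (f : CK) : continuous f.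
Proof. by have := valP f; rewrite inE. Qed.

Lemma CfunDE (f g : CK) x : (f + g : CK) x = f x + g x. Proof. by []. Qed.

Lemma CfunZE a (f : CK) x : (a *: f : CK) x = a * f x. Proof. by []. Qed.

Lemma cst_cont (c : R) : cst c \in @cont_pred K R.
Proof. by rewrite inE; exact: cst_continuous. Qed.

Definition Cfun_cst (c : R) : CK := Sub (cst c) (cst_cont c).

(* For empty [K] this is [sup set0 = 0]. *)
Definition sup_norm (f : CK) : R := sup [set `|f x| | x in [set: K]].

Lemma sup_norm_ubound (f : CK) : has_ubound [set `|f x| | x in [set: K]].
Proof.
have [->|K0] := eqVneq [set: K] set0.
  by rewrite image_set0; exists 0 => y [].
have [] := @compact_EVT_max K R (fun x => `|f x|) setT.
- exact/set0P.
- exact: cK.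
- apply: continuous_subspaceT => x.
  by apply: continuous_comp; [exact: Cfun_continuous|exact: norm_continuous].
- by move=> c _ fc; exists `|f c| => _ [x _ <-]; apply: fc; rewrite inE.
Qed.

Lemma sup_norm_ge (f : CK) x : `|f x| <= sup_norm f.
Proof. by apply: ub_le_sup; [exact: sup_norm_ubound|exists x]. Qed.

Lemma sup_norm_ge0 (f : CK) : 0 <= sup_norm f.
Proof.
rewrite /sup_norm; have [->|/set0P[x _]] := eqVneq [set: K] set0.
  by rewrite image_set0 sup0.
exact: le_trans (sup_norm_ge f x).
Qed.

Lemma sup_norm_le (f : CK) M : 0 <= M -> (forall x, `|f x| <= M) ->
  sup_norm f <= M.
Proof.
move=> M0 fM; rewrite /sup_norm.
have [->|/set0P[x _]] := eqVneq [set: K] set0; first by rewrite image_set0 sup0.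
by apply: ge_sup => [|_ [y _ <-]//]; exists `|f x|, x.
Qed.

Lemma sup_normD (f g : CK) : sup_norm (f + g) <= sup_norm f + sup_norm g.
Proof.
apply: sup_norm_le => [|x]; first by rewrite addr_ge0// sup_norm_ge0.
by rewrite CfunDE (le_trans (ler_normD _ _))// lerD// sup_norm_ge.
Qed.

Lemma sup_normZ (a : R) (f : CK) : sup_norm (a *: f) = `|a| * sup_norm f.
Proof.
have le b (g : CK) : sup_norm (b *: g) <= `|b| * sup_norm g.
  apply: sup_norm_le => [|x]; first by rewrite mulr_ge0// sup_norm_ge0.
  by rewrite CfunZE normrM ler_wpM2l// sup_norm_ge.
apply/eqP; rewrite eq_le le/=.
have [->|a0] := eqVneq a 0; first by rewrite normr0 mul0r sup_norm_ge0.
have := le a^-1 (a *: f); rewrite scalerA mulVf// scale1r => /(ler_wpM2l _).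
by move=> /(_ `|a| (normr_ge0 _)); rewrite mulrA normfV mulfV ?normr_eq0//
  mul1r.
Qed.

Lemma sup_norm_eq0 (f : CK) : sup_norm f = 0 -> f = 0.
Proof.
move=> f0; apply: CfunP => x; apply/eqP; rewrite -normr_le0.
by rewrite -f0 sup_norm_ge.
Qed.

HB.instance Definition _ :=
  Lmodule_isNormed.Build R CK sup_normD sup_normZ sup_norm_eq0.

End Cfun_norm.
Arguments Cfun_cst {K R cK}.

Section normed_subspace.
Context {R : realType} {E : normedModType R}.

Definition subnormed (Phi : submodClosed E) : Type := {f : E | f \in Phi}.

Variable Phi : submodClosed E.

HB.instance Definition _ := SubType.on (subnormed Phi).
HB.instance Definition _ := Choice.on (subnormed Phi).
HB.instance Definition _ := [SubChoice_isSubLmodule of subnormed Phi by <:].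

Lemma subnormed_valP (a : R) (u v : subnormed Phi) :
  \val (a *: u + v) = a *: \val u + \val v.
Proof. exact: linearP. Qed.

Definition subnormed_norm (u : subnormed Phi) : R := `|\val u|.

Lemma subnormed_normD u v :
  subnormed_norm (u + v) <= subnormed_norm u + subnormed_norm v.
Proof. by rewrite /subnormed_norm raddfD ler_normD. Qed.

Lemma subnormed_normZ (a : R) u :
  subnormed_norm (a *: u) = `|a| * subnormed_norm u.
Proof. by rewrite /subnormed_norm linearZ normrZ. Qed.

Lemma subnormed_norm_eq0 u : subnormed_norm u = 0 -> u = 0.
Proof. by move/normr0_eq0 => u0; apply: val_inj; rewrite u0 raddf0. Qed.

HB.instance Definition _ := Lmodule_isNormed.Build R (subnormed Phi)
  subnormed_normD subnormed_normZ subnormed_norm_eq0.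

End normed_subspace.

Section dual_space.
Context {R : realType} {V : normedModType R}.

Definition dual_pred : {pred V -> R} :=
  mem [set Q : V -> R | scalar Q /\ continuous Q].

Lemma dual_submod_closed : submod_closed dual_pred.
Proof.
split; first by rewrite inE; split=> [a u v|x];
  [rewrite /= mulr0 addr0|exact: cvg_cst].
move=> a f g; rewrite !inE => /= -[lf cf] [lg cg]; split=> [b u v|x].
  rewrite !fctE/= lf lg /GRing.scale/= !mulrDr addrACA; congr (_ + _ + _).
  by rewrite mulrCA.
exact: (@continuousD _ _ _ (a \*: f) g x
  (@continuousZr _ _ _ f a x (cf x)) (cg x)).
Qed.

HB.instance Definition _ := GRing.isSubmodClosed.Build R (V -> R) dual_pred
  dual_submod_closed.

End dual_space.

Definition dual {R : realType} (V : normedModType R) : Type :=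
  {Q : V -> R | Q \in dual_pred}.

Section dual_structure.
Context {R : realType} {V : normedModType R}.

HB.instance Definition _ := SubType.on (dual V).
HB.instance Definition _ := Choice.on (dual V).
HB.instance Definition _ := [SubChoice_isSubLmodule of dual V by <:].

Definition dual_fun (Q : dual V) : V -> R := \val Q.
Coercion dual_fun : dual >-> Funclass.

(* The topology carried by [dual V] is the weak-star one, i.e. that of
   pointwise convergence on [V]; the dual norm is [dual_norm] below. *)
HB.instance Definition _ := Topological.copy (dual V)
  (initial_topology (dual_fun : dual V -> {ptws V -> R})).

Definition dual_norm (Q : dual V) : R :=
  sup [set `|Q v| | v in [set v : V | `|v| <= 1]].

Definition wclosed_convex_hull (A : set (dual V)) : set (dual V) :=
  \bigcap_(B in [set B : set (dual V) |
    [/\ closed B, convex_set B & A `<=` B]]) B.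

End dual_structure.

Definition extreme_point {R : realType} {M : lmodType R} (A : set M) (x : M) :=
  A x /\ forall (y z : M) (t : R), A y -> A z -> 0 < t < 1 ->
    x = t *: y + (1 - t) *: z -> y = x /\ z = x.

Section Phi_convexity.
Context {K : topologicalType} {R : realType} {cK : compact [set: K]}.
Variable Phi : submodClosed (Cfun R cK).

Lemma evaluation_dual (x : K) :
  (fun phi : subnormed Phi => (\val phi : Cfun R cK) x) \in dual_pred.
Proof.
rewrite inE /=; set e := (fun phi => _).
have le : scalar e.
  move=> a u v; rewrite /e.
  rewrite subnormed_valP.
  by rewrite CfunDE CfunZE.
split=> //.
pose L := GRing.isLinear.Build R (subnormed Phi) R _ e le.
pose eL : {linear subnormed Phi -> R} := HB.pack e L.
apply: (@bounded_linear_continuous _ _ _ eL).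
exists 1; split => // M M1; apply/nbhs_ballP; exists 1 => //= phi.
rewrite -ball_normE/= sub0r normrN => phi1.
apply: le_trans (sup_norm_ge _ x) _.
exact: le_trans (ltW phi1) (ltW M1).
Qed.

Definition delta (x : K) : dual (subnormed Phi) :=
  exist (fun Q => Q \in dual_pred) _ (evaluation_dual x).

Definition contains_constants := forall c : R, Cfun_cst c \in Phi.

Definition subnormed_cst (Phic : contains_constants) (c : R) : subnormed Phi :=
  exist (fun f => f \in Phi) _ (Phic c).

Definition KPhi (Phic : contains_constants) : set (dual (subnormed Phi)) :=
  [set Q | dual_norm Q = 1 /\ Q (subnormed_cst Phic 1) = 1].

Variable X : set K.

Definition separates_points :=
  forall x y : X, x <> y ->
    exists2 phi : Cfun R cK, phi \in Phi & phi (\val x) <> phi (\val y).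

Definition deltaX (S : set X) : set (dual (subnormed Phi)) :=
  [set delta (\val x) | x in S].

Definition convex_trace (Phic : contains_constants) (C : set X) :=
  closed C /\ exists Chat : set (dual (subnormed Phi)),
    [/\ closed Chat, convex_set Chat, Chat `<=` KPhi Phic &
        deltaX C = deltaX setT `&` Chat].

Definition coPhi (Phic : contains_constants) (S : set X) : set X :=
  \bigcap_(C in [set C | convex_trace Phic C /\ S `<=` C]) C.

Definition ExtPhi (S : set X) : set X :=
  [set x | S x /\
    extreme_point (wclosed_convex_hull (deltaX S)) (delta (\val x))].

End Phi_convexity.

(* Main.v *)
Require Import Defs.
From HB Require Import structures.
From mathcomp Require Import all_boot all_order all_algebra.
From mathcomp Require Import all_classical all_reals all_analysis.
From mathcomp Require Import ring lra.

Set Implicit Arguments.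
Unset Strict Implicit.
Unset Printing Implicit Defensive.

Import Order.TTheory GRing.Theory Num.Theory.
Import numFieldNormedType.Exports.
Local Open Scope classical_set_scope.
Local Open Scope ring_scope.

(** The inclusion from right to left holds because Ext_Phi(S) is contained in
S. For the other one, let C be a convex-trace set containing Ext_Phi(S), traced
by a weak-star closed convex set A, and let x be in S. If delta(x) were not in
A, some phi in Phi would satisfy phi(x) < phi(y) for all y in Ext_Phi(S)
[dual_separation]. This is absurd, since phi attains its minimum over S at a
point of Ext_Phi(S) [exists_ExtPhi_minimizer]. So delta(x) is in A, and as Phi
separates the points of X, x is in C.

The core is thus the existence of Phi-extreme minimizers, which contains what is
needed of the Krein-Milman theorem and of Milman's converse. Both are obtained
at once by running the Krein-Milman argument on closed subsets of the compact
set S, instead of faces of the convex hull H of delta(S). A nonempty closed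
subset A of S is called a face when its closed convex hull is an extreme subset
of that of S, where the hull of A is described dually, as the set of the Q such
that Q(v) is at least the minimum of v on A, for all v. Cutting a face at the
minimum of some v gives a face [face_sublevel], and so does intersecting a chain
of faces [face_bigcap]. By Zorn's lemma there is a minimal face inside the set
of minimizers of phi on S. All elements of Phi are constant on it, so its hull
is a single delta(x), which is an extreme point of H. *)

(** * Chains of closed subsets of a compact set *)

Lemma compact_chain_bigcap (T : topologicalType) (S : set T) (I : Type)
    (D : set I) (f : I -> set T) :
  compact S -> D !=set0 ->
  (forall i, D i -> [/\ closed (f i), f i !=set0 & f i `<=` S]) ->
  (forall i j, D i -> D j -> f i `<=` f j \/ f j `<=` f i) ->
  \bigcap_(i in D) f i !=set0.
Proof.
move=> cS [i0 Di0] fP ftot.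
have Ff : Filter (filter_from D f).
  apply: filter_from_filter => [|i j Di Dj]; first by exists i0.
  by case: (ftot i j Di Dj) => fij; [exists i|exists j] => // x fx; split=> //;
    exact: fij.
have PFf : ProperFilter (filter_from D f).
  by apply: filter_from_proper => i /fP[].
have [|x [_ xf]] := cS (filter_from D f).
  by exists i0 => //; have [] := fP _ Di0.
exists x => i Di; have [clfi _ _] := fP _ Di; apply: clfi => B Bx.
by apply: xf => //; exists i.
Qed.

(** * Faces of a compact set of functionals *)

Section faces.
Context {R : realType} {V : lmodType R} {T : topologicalType}.
Variables (e : T -> {scalar V}) (S : set T).
Hypothesis ce : forall v, continuous (e ^~ v).
Hypothesis cS : compact S.
Implicit Types (A : set T) (Q : V -> R) (v : V).

(** As functions [e ^~ v] attain their minimum on a nonempty closed subset A of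
S, this says that Q v is at least that minimum for every v; by Hahn-Banach, such
linear Q form the closed convex hull of the image of A for the topology of
pointwise convergence. *)
Definition supported_by A Q := forall v, exists2 x, A x & e x v <= Q v.

(** The last condition says that the hull of A is an extreme subset of the hull
of S. *)
Definition face A := [/\ closed A, A !=set0, A `<=` S &
  forall (Q1 Q2 : {scalar V}) (t : R), 0 < t < 1 ->
    supported_by S Q1 -> supported_by S Q2 ->
    supported_by A (fun v => t * Q1 v + (1 - t) * Q2 v) ->
    supported_by A Q1 /\ supported_by A Q2].

Lemma supported_byS A B Q : A `<=` B -> supported_by A Q -> supported_by B Q.
Proof. by move=> AB AQ v; have [x Ax xQ] := AQ v; exists x => //; exact: AB. Qed.

Lemma closed_sublevel v (m : R) : closed [set x | e x v <= m].
Proof.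
apply: (@preimage_closed _ _ (e ^~ v) [set y | y <= m]); last exact: closed_le.
by move=> x _; exact: ce.
Qed.

(** If Q is in the hull of every [f i], then for each v the sets
[f i `&` [set x | e x v <= Q v]] form a chain of nonempty closed sets, and a
point common to all of them shows that Q is in the hull of the intersection. *)
Lemma face_bigcap (I : Type) (D : set I) (f : I -> set T) :
  D !=set0 -> (forall i, D i -> face (f i)) ->
  (forall i j, D i -> D j -> f i `<=` f j \/ f j `<=` f i) ->
  face (\bigcap_(i in D) f i).
Proof.
move=> D0 fF ftot; have [i0 Di0] := D0; split.
- by apply: closed_bigI => i /fF[].
- by apply: (compact_chain_bigcap cS) => // i /fF[].
- by move=> x /(_ _ Di0); have [_ _ + _] := fF _ Di0; apply.
move=> Q1 Q2 t t01 SQ1 SQ2 fQ.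
have H Q : (forall i, D i -> supported_by (f i) Q) ->
    supported_by (\bigcap_(i in D) f i) Q.
  move=> fiQ v.
  suff [x fx] : \bigcap_(i in D) (f i `&` [set x | e x v <= Q v]) !=set0.
    by exists x => [i /fx[]|]//; have [] := fx _ Di0.
  apply: (compact_chain_bigcap cS) => // [i Di|i j Di Dj].
    have [clf _ fS _] := fF _ Di; split.
    - by apply: closedI => //; exact: closed_sublevel.
    - by have [x fx xQ] := fiQ _ Di v; exists x.
    - by move=> x [/fS].
  by case: (ftot i j Di Dj) => fij; [left|right] => x [/fij].
by split; apply: H => i Di; have [_ _ _ /(_ Q1 Q2 t t01 SQ1 SQ2)] := fF _ Di;
  case=> //; apply: supported_byS fQ => x /(_ _ Di).
Qed.

(** An element of the hull of A that takes at v the minimum m of v on A lies in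
the hull of the minimizers of v. Given w, for each n there is a point x of A
with [e x (n%:R *: v + w) <= n%:R * m + Q w]; when n grows, this condition
becomes more restrictive, and a point that satisfies it for all n minimizes v
and has [e x w <= Q w]. *)
Lemma supported_by_sublevel A (Q : {scalar V}) v (m : R) :
  closed A -> A `<=` S ->
  (forall x, A x -> m <= e x v) -> supported_by A Q -> Q v <= m ->
  supported_by (A `&` [set x | e x v <= m]) Q.
Proof.
move=> clA AS mA AQ Qm w.
pose C n := A `&` [set x | e x (n%:R *: v + w) <= n%:R * m + Q w].
suff [x Cx] : \bigcap_(n in setT) C n !=set0.
  have [Ax] := Cx 0%N I; rewrite /= scale0r add0r mul0r add0r => xw.
  exists x => //; split => //=; rewrite leNgt; apply/negP => mx.
  have mx0 : 0 < e x v - m by rewrite subr_gt0.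
  pose k := (Q w - e x w) / (e x v - m).
  have k0 : 0 <= k by rewrite divr_ge0 ?subr_ge0// ltW.
  have [_ /=] := Cx (Num.Def.archi_bound k) I.
  rewrite linearP/=; have := archi_boundP k0; rewrite ltr_pdivrMr//.
  set n := _%:R; lra.
apply: (compact_chain_bigcap cS) => [|n _|i j _ _]; first by exists 0%N.
  split; first by apply: closedI => //; exact: closed_sublevel.
    have [x Ax xQ] := AQ (n%:R *: v + w); exists x; split => //=.
    by rewrite (le_trans xQ)// linearP/= lerD2r ler_wpM2l.
  by move=> x [/AS].
have Cle a b : (a <= b)%N -> C b `<=` C a.
  move=> ab x [Ax]; rewrite /= !linearP/= => xb; split => //=.
  rewrite linearP /=.
  have : 0 <= (b%:R - a%:R) * (e x v - m).
    by rewrite mulr_ge0// subr_ge0 ?ler_nat// mA.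
  lra.
by case: (leqP i j) => [/Cle|/ltnW/Cle]; [right|left].
Qed.

(** Q1 and Q2 take values at least m at v; if a strict convex combination of
them takes the value m, so do both. *)
Lemma face_sublevel A v (m : R) : face A ->
  (forall x, A x -> m <= e x v) -> (exists2 x, A x & e x v <= m) ->
  face (A `&` [set x | e x v <= m]).
Proof.
move=> [clA A0 AS AF] mA [x0 Ax0 x0m]; split.
- by apply: closedI => //; exact: closed_sublevel.
- by exists x0.
- by move=> x [/AS].
move=> Q1 Q2 t t01 SQ1 SQ2 AQ; have /andP[t0 t1] := t01.
have [AQ1 AQ2] : supported_by A Q1 /\ supported_by A Q2.
  by apply: (AF Q1 Q2 t) => //; apply: supported_byS AQ => x [].
have ge Q : supported_by A Q -> m <= Q v.
  by move=> /(_ v)[x /mA mx]; exact: le_trans.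
have [x [_ /= xm]] := AQ (- v); rewrite !linearN/= => xQ.
have t1' : 0 < 1 - t by rewrite subr_gt0.
have Q1m : 0 <= t * (Q1 v - m) by rewrite mulr_ge0 ?subr_ge0 ?ge// ltW.
have Q2m : 0 <= (1 - t) * (Q2 v - m) by rewrite mulr_ge0 ?subr_ge0 ?ge// ltW.
split; apply: supported_by_sublevel => //.
  by rewrite -subr_le0 -(pmulr_rle0 _ t0); lra.
by rewrite -subr_le0 -(pmulr_rle0 _ t1'); lra.
Qed.

(** Zorn's lemma is applied to the complements in A of the faces inside A. *)
Lemma minimal_face A : face A -> exists B, [/\ face B, B `<=` A &
  forall C, face C -> C `<=` B -> B `<=` C].
Proof.
move=> FA.
have [F FP Ftot|B [FB Bmax]] := @Zorn_bigcup T [set B | face (A `\` B)].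
  have [->|/set0P F0] := eqVneq F set0; first by rewrite /= bigcup_set0 setD0.
  rewrite /= -bigcupDr//; apply: face_bigcap => // B C FB FC.
  by have [BC|CB] := Ftot B C FB FC; [right|left]; exact: setDS.
exists (A `\` B); split => // C FC CAB.
apply: contrapT => nBC; apply: (Bmax (~` C)).
  split; last by move=> CB; apply: nBC => x [_ Bx]; apply: contrapT => /CB.
  by move=> y By /CAB[].
by rewrite /= setDE setCK setIidr// => y /CAB[].
Qed.

(** The point x spans a minimal face inside the set of minimizers of v: every
function [e ^~ w] is constant on a minimal face B, so [e x] is the only linear
functional in the hull of B. *)
Theorem exists_extreme_minimizer v : S !=set0 -> closed S ->
  exists x, [/\ S x, (forall y, S y -> e x v <= e y v) &
    forall (Q1 Q2 : {scalar V}) (t : R), 0 < t < 1 ->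
      supported_by S Q1 -> supported_by S Q2 ->
      (forall w, e x w = t * Q1 w + (1 - t) * Q2 w) ->
      Q1 =1 e x /\ Q2 =1 e x].
Proof.
move=> S0 clS.
have emin A w : face A -> exists2 x, A x & forall y, A y -> e x w <= e y w.
  move=> [clA A0 AS _].
  have [||x] := @compact_EVT_min T R (e ^~ w) A A0.
  - by apply: (subclosed_compact clA cS).
  - by apply: continuous_subspaceT; exact: ce.
  by rewrite inE => Ax xmin; exists x => // y Ay; apply: xmin; rewrite inE.
have FS : face S by split.
have [x0 Sx0 x0min] := emin _ v FS.
have F0 : face (S `&` [set x | e x v <= e x0 v]).
  by apply: face_sublevel => //; exists x0.
have [B [FB BS Bmin]] := minimal_face F0.
have cstB x y w : B x -> B y -> e x w = e y w.
  suff H a b : B a -> B b -> e a w <= e b w.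
    by move=> Bx By; apply/eqP; rewrite eq_le !H.
  move=> Ba Bb; have [z Bz zmin] := emin B w FB.
  suff /(_ _ Ba)[_ /= az] : B `<=` B `&` [set x | e x w <= e z w].
    exact: le_trans az (zmin _ Bb).
  by apply: Bmin => [|? []//]; apply: face_sublevel => //; exists z.
have [clB [x Bx] BSS Bext] := FB.
have [Sx /= xx0] := BS _ Bx.
exists x; split => //.
  by move=> y Sy; exact: le_trans xx0 (x0min _ Sy).
move=> Q1 Q2 t t01 SQ1 SQ2 xQ.
have [||||BQ1 BQ2] := Bext Q1 Q2 t => //.
  by move=> w; exists x => //; rewrite xQ.
have eqQ (Q : {scalar V}) : supported_by B Q -> Q =1 e x.
  have le w : supported_by B Q -> e x w <= Q w.
    by move=> /(_ w)[y By]; rewrite (cstB y x).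
  move=> BQ w; apply/eqP; rewrite eq_le le// andbT.
  by have := le (- w) BQ; rewrite !linearN lerN2.
by split; exact: eqQ.
Qed.
End faces.

(** * Separation in the weak-star topology *)

Section weak_star.
Context {R : realType} {V : normedModType R}.
Implicit Types (Q q c : dual V) (v : V).

Lemma dual_scalar Q : scalar Q.
Proof. by have := valP Q; rewrite inE => -[]. Qed.

HB.instance Definition _ Q :=
  GRing.isLinear.Build R V R *%R (dual_fun Q) (dual_scalar Q).

Lemma dual_funZ Q a v : Q (a *: v) = a * Q v.
Proof. by rewrite linearZ. Qed.

Lemma dual_evalE (a b : R) Q1 Q2 v :
  (a *: Q1 + b *: Q2 : dual V) v = a * Q1 v + b * Q2 v.
Proof. by []. Qed.

Lemma continuous_dual_eval v : continuous (fun Q : dual V => Q v).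
Proof.
move=> Q.
apply: (@continuous_comp _ _ _ (dual_fun : dual V -> {ptws V -> R})
  (fun f : {ptws V -> R} => f v)).
  exact: (@initial_continuous _ _ (dual_fun : dual V -> {ptws V -> R})).
exact: (@proj_continuous _ (fun=> R) v).
Qed.

Lemma closed_dual_ge v (m : R) : closed [set Q : dual V | m <= Q v].
Proof.
apply: (@preimage_closed _ _ (fun Q : dual V => Q v) [set y | m <= y]).
  by move=> Q _; exact: continuous_dual_eval.
exact: closed_ge.
Qed.

Lemma convex_dual_ge v (m : R) : convex_set [set Q : dual V | m <= Q v].
Proof.
move=> Q1 Q2 t; rewrite !inE/= => m1 m2.
rewrite -[conv _ _ _]/(t%:num *: Q1 + (1 - t%:num) *: Q2) dual_evalE.
have t0 : 0 <= t%:num by [].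
have t1 : 0 <= 1 - t%:num by rewrite subr_ge0.
have := ler_wpM2l t0 m1; have := ler_wpM2l t1 m2; lra.
Qed.

(** The sets on the left form a filter base that converges pointwise to q, so
this filter refines the neighbourhoods of q. *)
Lemma nbhs_dual q (U : set (dual V)) : nbhs q U ->
  exists (s : seq V) (eps : R), 0 < eps /\
    [set Q : dual V | {in s, forall v, `|Q v - q v| < eps}] `<=` U.
Proof.
pose F := filter_from [set p : seq V * R | 0 < p.2]
  (fun p => [set Q : dual V | {in p.1, forall v, `|Q v - q v| < p.2}]).
have FF : Filter F.
  apply: filter_from_filter => [|[s1 e1] [s2 e2] /= e10 e20].
    by exists ([::], 1) => /=.
  exists (s1 ++ s2, Num.min e1 e2) => /=; first by rewrite lt_min e10.
  by move=> Q /= Qs; split=> v vs; have := Qs v; rewrite mem_cat vs ?orbT;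
    move=> /(_ isT); rewrite lt_min => /andP[].
have cvgF : (dual_fun @ F : set_system {ptws V -> R}) -->
    (dual_fun q : {ptws V -> R}).
  apply/pointwise_cvgP => v; apply/cvgrPdist_lt => eps eps0.
  exists ([:: v], eps) => //= Q /(_ v); rewrite inE eqxx distrC; exact.
case=> B [[C oC CB] Bq BU].
have /cvgF : nbhs (dual_fun q : {ptws V -> R}) C.
  by apply: open_nbhs_nbhs; split => //; rewrite -CB in Bq.
case=> -[s eps] /= eps0 sC; exists s, eps; split => // Q /sC QC.
by apply: BU; rewrite -CB.
Qed.

(** Some weak-star neighbourhood of q that misses A only involves a finite
family s of vectors, so the squared distance D in the coordinates v of s has a
positive infimum d on A. Let c in A nearly realize it. If the functional with
gradient c - q did not separate q from Q in B, the angle at q between c and Q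
would be at least right, and a point of the segment from c to Q would be closer
to q than d allows. As Q stays bounded on B, how near c has to be does not
depend on Q; this uniformity replaces the compactness that a true nearest point
would require. *)
Lemma dual_separation (A B : set (dual V)) q :
  closed A -> convex_set A -> ~ A q -> B `<=` A ->
  (forall v, exists M : R, forall Q, B Q -> `|Q v| <= M) ->
  exists v, forall Q, B Q -> q v < Q v.
Proof.
move=> clA cA Aq BA bB.
have [->|/set0P[Q0 BQ0]] := eqVneq B set0; first by exists 0.
have [N qN AN] : exists2 N, nbhs q N & A `&` N = set0.
  apply: contrapT => nN; apply: Aq; apply: clA => N qN.
  by apply/set0P/eqP => AN; apply: nN; exists N.
have [s [eps [eps0 sN]]] := nbhs_dual qN.
pose D Q := \sum_(v <- s) (Q v - q v) ^+ 2.
have Deps Q : A Q -> eps ^+ 2 <= D Q.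
  move=> AQ; rewrite leNgt; apply/negP => Dlt.
  suff : set0 Q by [].
  rewrite -AN.
  split => //; apply: sN => v vs /=; rewrite ltNge; apply/negP => ev.
  move: Dlt; rewrite ltNge => /negP; apply.
  rewrite /D (big_rem v)//= -[X in X <= _]addr0 lerD//.
    by rewrite -[leRHS]real_normK ?num_real// lerXn2r ?nnegrE// ltW.
  by apply: sumr_ge0 => w _; exact: sqr_ge0.
have [M M0 BM] : exists2 M : R, 0 <= M & forall Q, B Q -> D Q <= M.
  have [m mP] := choice bB.
  exists (\sum_(v <- s) (m v + `|q v|) ^+ 2).
    by apply: sumr_ge0 => v _; exact: sqr_ge0.
  move=> Q BQ; apply: ler_sum => v _.
  have Qm := mP v Q BQ.
  rewrite -[leLHS]real_normK ?num_real// lerXn2r ?nnegrE//.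
    by rewrite addr_ge0// (le_trans _ Qm).
  by rewrite (le_trans (ler_normB _ _))// lerD2r.
pose d := inf [set D Q | Q in A].
have hd : has_inf [set D Q | Q in A].
  split; first by exists (D Q0), Q0 => //; exact: BA.
  by exists (eps ^+ 2) => _ [Q /Deps + <-].
have dle Q : A Q -> d <= D Q.
  by move=> AQ; apply: ge_inf; [case: hd|exists Q].
have d0 : 0 < d.
  apply: (@lt_le_trans _ _ (eps ^+ 2)); first by rewrite exprn_gt0.
  by apply: lb_le_inf; [case: hd|move=> _ [Q /Deps + <-]].
have M1 : 0 < M + 1 by rewrite ltr_wpDl.
(* The slack d^2 / (M + 1) makes c close enough for every Q with D Q <= M. *)
have [|_ [c Ac <-] cd] := @inf_adherent R _ (d ^+ 2 / (M + 1)) _ hd.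
  by rewrite divr_gt0// exprn_gt0.
rewrite -/d in cd.
exists (\sum_(v <- s) (c v - q v) *: v) => Q BQ.
rewrite ltNge; apply/negP => Qq.
(* P is the inner product of c - q and Q - q. *)
pose P := \sum_(v <- s) (c v - q v) * (Q v - q v).
have P0 : P <= 0.
  move: Qq; rewrite !linear_sum/= -subr_le0 -sumrB; congr (_ <= _).
  by apply: eq_bigr => v _; rewrite !dual_funZ mulrBr.
have Dt (t : R) : 0 <= t -> t <= 1 ->
    d <= (1 - t) ^+ 2 * D c + 2 * t * (1 - t) * P + t ^+ 2 * D Q.
  move=> t0 t1; have := cA Q c (Itv01 t0 t1); rewrite !inE.
  move=> /(_ (BA _ BQ) Ac) /dle; rewrite -[conv _ _ _]/(t *: Q + (1 - t) *: c).
  congr (_ <= _).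
  rewrite /D /P !mulr_sumr -!big_split/=; apply: eq_bigr => v _.
  by rewrite dual_evalE; ring.
have Dc := dle _ Ac.
have X0 : 0 < D c + M by rewrite ltr_pwDl// (lt_le_trans d0).
(* This t minimizes (1 - t)^2 D(c) + t^2 M, with minimum D(c) M / (D(c) + M). *)
pose t := D c / (D c + M).
have t0 : 0 <= t by rewrite divr_ge0 ?(ltW X0)// (le_trans (ltW d0)).
have t1 : t <= 1 by rewrite ler_pdivrMr// mul1r lerDl.
have := Dt t t0 t1; rewrite leNgt => /negP; apply.
have BMQ := BM _ BQ.
have : t ^+ 2 * D Q <= t ^+ 2 * M by rewrite ler_wpM2l// sqr_ge0.
have : 2 * t * (1 - t) * P <= 0.
  apply: mulr_ge0_le0 => //; apply: mulr_ge0; last by rewrite subr_ge0.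
  exact: mulr_ge0.
suff : (1 - t) ^+ 2 * D c + t ^+ 2 * M < d by lra.
have -> : (1 - t) ^+ 2 * D c + t ^+ 2 * M = D c * M / (D c + M).
  by rewrite /t; field; rewrite gt_eqF.
rewrite ltr_pdivrMr//.
have : (D c - d) * (M + 1) < d ^+ 2.
  by rewrite -ltr_pdivlMr// ltrBlDl.
have : d ^+ 2 <= d * D c by rewrite expr2 ler_wpM2l// ltW.
lra.
Qed.

End weak_star.

(** * Minimizers in Ext_Phi(S) *)

Section delta_map.
Context {R : realType} {K : topologicalType} {cK : compact [set: K]}.
Variables (Phi : submodClosed (Cfun R cK)) (X : set K).
Implicit Types (S : set X) (phi : subnormed Phi).

Definition evalX (x : X) : {scalar subnormed Phi} :=
  dual_fun (delta Phi (\val x)).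

Lemma continuous_evalX phi : continuous (evalX ^~ phi).
Proof.
move=> x; apply: (@continuous_comp _ _ _ (\val : X -> K) (\val phi : Cfun R cK)).
  exact: (@initial_continuous _ _ (\val : X -> K)).
exact: Cfun_continuous.
Qed.

(** Each half-space cut out by an element of Phi at its minimum over S is
weak-star closed and convex, and contains the image of S. *)
Lemma hull_supported S (Q : dual (subnormed Phi)) : S !=set0 -> compact S ->
  wclosed_convex_hull (deltaX S : set (dual (subnormed Phi))) Q ->
  supported_by evalX S Q.
Proof.
move=> S0 cS HQ phi.
have [|x] := @compact_EVT_min X R (evalX ^~ phi) S S0 cS.
  by apply: continuous_subspaceT; exact: continuous_evalX.
rewrite inE => Sx xmin; exists x => //.
apply: (HQ [set Q | evalX x phi <= Q phi]); split.
- exact: closed_dual_ge.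
- exact: convex_dual_ge.
- by move=> _ [y Sy <-]; apply: xmin; rewrite inE.
Qed.

(** For compact S, the set Ext_Phi(S) is a boundary: every element of Phi
attains on it its minimum over S. *)
Lemma exists_ExtPhi_minimizer S phi : hausdorff_space X -> compact S ->
  S !=set0 -> exists2 x, ExtPhi Phi S x &
    forall y, S y -> evalX x phi <= evalX y phi.
Proof.
move=> hX cS S0.
have [x [Sx xmin xext]] := exists_extreme_minimizer continuous_evalX cS phi S0
  (compact_closed hX cS).
exists x => //; split => //; split.
  by move=> B [_ _]; apply; exists x.
move=> Q1 Q2 t HQ1 HQ2 t01 xQ.
have [|||Q1x Q2x] := xext (dual_fun Q1) (dual_fun Q2) t t01.
- exact: hull_supported HQ1.
- exact: hull_supported HQ2.
- by move=> w; rewrite -dual_evalE -xQ.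
by split; apply/val_inj/funext.
Qed.

Lemma delta_injective : separates_points Phi X ->
  injective (fun x : X => delta Phi (\val x)).
Proof.
move=> sep x y xy; apply: contrapT => /sep[f fPhi]; apply.
exact: (congr1 (fun Q : dual (subnormed Phi) => Q (exist _ f fPhi)) xy).
Qed.

End delta_map.

(** * Convex-trace sets and the Phi-convex hull *)

Section convexity.
Context {R : realType} {K : topologicalType} {cK : compact [set: K]}.
Variables (Phi : submodClosed (Cfun R cK)) (X : set K).
Hypothesis Phic : contains_constants Phi.
Implicit Types (S C : set X).

Lemma sub_coPhi S : S `<=` coPhi Phic S.
Proof. by move=> x Sx C [_]; apply. Qed.

Lemma coPhiS S S' : S `<=` S' -> coPhi Phic S `<=` coPhi Phic S'.
Proof. by move=> SS' x Sx C [cC S'C]; apply: Sx; split=> // y /SS' /S'C. Qed.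

(** A point x of S whose image lies outside the convex set that traces C would
be strictly separated from the image of Ext_Phi(S) by some phi in Phi; but phi
attains its minimum over S on Ext_Phi(S), hence a value at most phi(x). *)
Lemma ExtPhi_sub S C : hausdorff_space X -> separates_points Phi X ->
  compact S -> convex_trace Phic C -> ExtPhi Phi S `<=` C -> S `<=` C.
Proof.
move=> hX sep cS [_ [Chat [clC cC _ CE]]] EC x Sx.
suff Cx : Chat (delta Phi (\val x)).
  have : deltaX C (delta Phi (\val x)) by rewrite CE; split => //; exists x.
  by case=> y Cy /(delta_injective sep) <-.
apply: contrapT => nCx.
have [||phi sepphi] := @dual_separation _ _ Chat (deltaX (ExtPhi Phi S)) _
  clC cC nCx.
- move=> Q [y /EC Cy <-].
  have : deltaX C (delta Phi (\val y)) by exists y.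
  by rewrite CE => -[].
- move=> phi; exists `|\val phi| => Q [y _ <-].
  exact: sup_norm_ge.
have [y Ey ymin] := exists_ExtPhi_minimizer phi hX cS (ex_intro _ x Sx).
have := sepphi (delta Phi (\val y)) (ex_intro2 _ _ y Ey erefl).
by rewrite ltNge => /negP; apply; exact: ymin.
Qed.

End convexity.

Theorem theorem24 (R : realType) (K : topologicalType)
    (cK : compact [set: K]) (hK : hausdorff_space K)
    (X : set K) (dX : dense X)
    (hX : hausdorff_space X) (crX : completely_regular_space X)
    (Phi : submodClosed (Cfun R cK))
    (Phi_closed : closed [set f : Cfun R cK | f \in Phi])
    (Phic : contains_constants Phi)
    (Phi_sep : separates_points Phi X) :
  (forall S : set X, compact S ->
     coPhi Phic S = coPhi Phic (ExtPhi Phi S)) /\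
  (forall C : set X, compact C -> convex_trace Phic C ->
     C = coPhi Phic (ExtPhi Phi C)).
Proof.
have coE (S : set X) : compact S -> coPhi Phic S = coPhi Phic (ExtPhi Phi S).
  move=> cS; apply/seteqP; split; last by apply: coPhiS => x [].
  by move=> x Sx C [tC EC]; apply: Sx; split => //; exact: ExtPhi_sub EC.
split => // C cC tC; rewrite -coE//; apply/seteqP; split.
  exact: sub_coPhi.
by move=> x; apply; split.
Qed.
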